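(* Let $p$ be a prime and $q=1/p$. For integers $n\ge1$, $\mu\ge1$, let $P(n,p^\mu)$ be the probability that a random symmetric $n\times n$ matrix over $\mathbf{Z}_{p^\mu}$ has determinant $\not\equiv 0\pmod{p^\mu}$, and extend this by the boundary conditions $P(0,p^\mu)=1$ for $\mu>0$ and $P(n,p^\mu)=0$ for $\mu\le 0$ (all $n\ge0$). Let $\mu>0$. Then for every odd $n\ge 3$, $$P(n,p^\mu)=(1-q^n)P(n-2,p^\mu)+q^nP(n,p^{\mu-2}),$$ and for every odd $n\ge 1$, $$P(n-1,p^\mu)=\frac{P(n,p^\mu)-q^nP(n,p^{\mu-1})}{1-q^n}.$$
   Context: For a positive integer $m$, $\mathbf{Z}_m=\{1,2,\ldots,m\}$ (viewed as residues mod $m$). A random symmetric $n\times n$ matrix over $\mathbf{Z}_m$ is one whose entries $a_{ij}$, $i\le j$, are chosen independently and uniformly from $\mathbf{Z}_m$, with $a_{ji}=a_{ij}$. *)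

(* Defs.v *)
From HB Require Import structures.
From mathcomp Require Import all_boot all_order all_algebra.
Set Implicit Arguments. Unset Strict Implicit. Unset Printing Implicit Defensive.
Import Order.TTheory GRing.Theory Num.Theory.
Local Open Scope ring_scope.

(* Probability that a uniformly random symmetric n x n matrix over Z/mZ
   (entries a_ij, i <= j, independent uniform) has nonzero determinant mod m.
   Uniform choice of the upper-triangular entries is the same as the uniform
   distribution on the finite set of symmetric matrices in 'M['Z_m]_n.
   Intended for m >= 2 (where 'Z_m is Z/mZ). *)
Definition symmetric_mx (m n : nat) : {set 'M['Z_m]_n} :=
  [set A : 'M['Z_m]_n | A^T == A].

Definition prob_nonsing_sym (m n : nat) : rat :=
  (#|[set A in symmetric_mx m n | \det A != 0]|)%:R
  / (#|symmetric_mx m n|)%:R.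

(* P(n, p^mu) with the boundary convention P(n, p^mu) = 0 for mu <= 0.
   (P(0, p^mu) = 1 for mu > 0 holds automatically: det of the 0x0 matrix is 1.) *)
Definition Pnp (p n : nat) (mu : int) : rat :=
  if (mu <= 0)%R then 0 else prob_nonsing_sym (p ^ `|mu|%N) n.

(* Main.v *)
(* Let f_n(mu) be the probability that p^mu does not divide the determinant of
   a random symmetric n x n matrix, and let x be the shift mu |-> mu - 1.  Look
   at the first row (a, b) of the matrix.
   - If a is a unit, the Schur complement of a is again uniform, of size n - 1.
   - If p | a but some entry of b is a unit, a congruence moves b to (1,0,..,0)
     and the resulting 2 x 2 unit pivot leaves a uniform matrix of size n - 2.
   - If the whole row is p (a', b'), then a factor p comes out of the row.  If a'
     is a unit, pivoting on it leaves a uniform matrix of size n - 1; otherwise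
     a' = p a'', a second factor p comes out of the first column, and what is
     left is a uniform matrix of size n.
   This gives, with q = 1/p,
     (1 - q^(n+1) x^2) f_n
       = (1 - q) (1 + q^n x) f_(n-1) + q (1 - q^(n-1)) f_(n-2),
   and both identities follow by induction, together with
     (1 - q^(m+1) x^2) f_m = (1 - q^(m+1) x) f_(m-1)   for m even,
   because polynomials in x with constant term 1 can be cancelled. *)
Require Import Defs.
From HB Require Import structures.
From mathcomp Require Import all_boot all_order all_algebra perm.
From mathcomp Require Import ring zify.
Set Implicit Arguments.
Unset Strict Implicit.
Unset Printing Implicit Defensive.

Import Order.TTheory GRing.Theory Num.Theory.
Local Open Scope ring_scope.

(** * Sums over symmetric matrices and determinants of bordered matrices *)

Section SymmetricSums.
Variable R : finComUnitRingType.

Lemma sum_sym_block n (F : 'M[R]_(1 + n) -> rat) :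
  \sum_(A : 'M[R]_(1 + n) | A^T == A) F A
  = \sum_(a : R) \sum_(b : 'rV[R]_n) \sum_(D : 'M[R]_n | D^T == D)
      F (block_mx a%:M b b^T D).
Proof.
under [RHS]eq_bigr => a _ do rewrite pair_big_dep /=.
rewrite pair_big_dep /=.
rewrite (reindex_onto
  (fun x : R * ('rV[R]_n * 'M[R]_n) => block_mx x.1%:M x.2.1 x.2.1^T x.2.2)
  (fun A => (ulsubmx A 0 0, (ursubmx A, drsubmx A)))).
  apply: eq_bigl => -[a [b D]] /=.
  rewrite block_mxKul block_mxKur block_mxKdr tr_block_mx trmxK tr_scalar_mx.
  rewrite mxE eqxx mulr1n eqxx andbT.
  by apply/eqP/eqP => [/eq_block_mx[]|->].
move=> A /eqP symA /=.
rewrite -mx11_scalar trmx_ursub symA submxK //.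
Qed.

Lemma sum_sym_shift n (S : 'M[R]_n) (F : 'M[R]_n -> rat) : S^T = S ->
  \sum_(D : 'M[R]_n | D^T == D) F (D + S) = \sum_(D : 'M[R]_n | D^T == D) F D.
Proof.
move=> symS; rewrite [RHS](reindex_inj (addIr S)).
by apply: eq_bigl => D; rewrite linearD /= symS (inj_eq (addIr S)).
Qed.

Lemma sum_sym_congruence n (U : 'M[R]_n) (F : 'M[R]_n -> rat) :
  U \in unitmx ->
  \sum_(D : 'M[R]_n | D^T == D) F (U^T *m D *m U)
  = \sum_(D : 'M[R]_n | D^T == D) F D.
Proof.
move=> unitU; have unitUt : U^T \in unitmx by rewrite unitmx_tr.
have inj : injective (fun D => U^T *m D *m U).
  by move=> D E /(can_inj (mulmxK unitU)) /(can_inj (mulKmx unitUt)).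
rewrite [RHS](reindex_inj inj); apply: eq_bigl => D.
by rewrite !trmx_mul trmxK mulmxA (inj_eq inj).
Qed.

(** The column [c] is independent of [b] because taking a factor [p] out of the first row alone
    destroys symmetry. *)
Lemma det_pivot n (a : R) (b : 'rV[R]_n) (c : 'cV[R]_n) (D : 'M[R]_n) :
  a \is a GRing.unit ->
  \det (block_mx a%:M b c D) = a * \det (D - a^-1 *: (c *m b)).
Proof.
move=> unita.
have -> : block_mx a%:M b c D = block_mx 1%:M 0 (a^-1 *: c) 1%:M
    *m block_mx a%:M b 0 (D - a^-1 *: (c *m b)).
  rewrite mulmx_block !mul1mx !mul0mx !addr0 mul_mx_scalar scalerA.
  by rewrite divrr // scale1r -scalemxAl addrC subrK.
by rewrite det_mulmx det_lblock det_ublock !det1 !mul1r det_scalar1.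
Qed.

Lemma det_scale_row n k (a : R) (b : 'rV[R]_n) (c : 'cV[R]_n) (D : 'M[R]_n) :
  \det (block_mx (k * a)%:M (k *: b) c D) = k * \det (block_mx a%:M b c D).
Proof.
have -> : block_mx (k * a)%:M (k *: b) c D
    = block_mx k%:M 0 0 1%:M *m block_mx a%:M b c D.
  rewrite mulmx_block !mul_scalar_mx !mul0mx !addr0 !add0r !scale1r.
  by rewrite scale_scalar_mx.
by rewrite det_mulmx det_ublock det_scalar1 det1 mulr1.
Qed.

Lemma det_scale_col n k (a : R) (b : 'rV[R]_n) (c : 'cV[R]_n) (D : 'M[R]_n) :
  \det (block_mx (k * a)%:M b (k *: c) D) = k * \det (block_mx a%:M b c D).
Proof.
rewrite -det_tr tr_block_mx tr_scalar_mx linearZ /= det_scale_row.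
by rewrite -[in RHS]det_tr tr_block_mx tr_scalar_mx.
Qed.

(** A transposition brings the unit entry to the front; a column operation then divides by it and
    clears the rest. *)
Lemma unit_row_completion n (b : 'rV[R]_(1 + n)) j : b 0 j \is a GRing.unit ->
  exists2 U, U \in unitmx & b *m U = row_mx 1%:M 0.
Proof.
move=> unitb; pose b' : 'rV_(1 + n) := xcol 0 j b; pose u := b 0 j.
have b'0 : lsubmx b' = u%:M.
  rewrite [LHS]mx11_scalar !mxE /u; congr (_ 0 _)%:M.
  rewrite (_ : lshift n 0 = 0); last exact: val_inj.
  by rewrite tpermL.
pose V := block_mx (u^-1)%:M (- u^-1 *: rsubmx b') 0 1%:M.
exists (tperm_mx 0 j *m V).
  rewrite unitmx_mul unitmx_perm /= unitmxE det_ublock det1 mulr1 det_scalar1.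
  by rewrite unitrV.
have -> : b *m (tperm_mx 0 j *m V) = b' *m V by rewrite mulmxA -xcolE.
rewrite -[b' in LHS]hsubmxK b'0 mul_row_block !mulmx0 addr0 mulmx1.
rewrite mul_scalar_mx scale_scalar_mx divrr // mul_scalar_mx scalerA.
by rewrite mulrN divrr // scaleN1r addNr.
Qed.

End SymmetricSums.

(** Multiplication by [k] is an endomorphism of [V] with image [P]; its fibres are cosets of the
    kernel, so each has [K] elements. *)
Lemma sum_multiples (V : finZmodType) (P : pred V) k (F : V -> rat) :
  (forall y, reflect (exists x, y = x *+ k) (P y)) ->
  \sum_(y | P y) F y = #|P|%:R / #|V|%:R * \sum_x F (x *+ k).
Proof.
move=> imP.
pose K : rat := \sum_(x : V | x *+ k == 0) 1.
have fibres G : \sum_x G (x *+ k) = K * \sum_(y | P y) G y :> rat.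
  rewrite (partition_big (fun x => x *+ k) P) => [|x _]; last by apply/imP; exists x.
  rewrite mulr_sumr; apply: eq_bigr => _ /imP[x0 ->].
  rewrite /K mulr_suml (reindex_inj (addIr x0)) /=.
  apply: eq_big => [x|x /eqP ->]; rewrite ?mul1r //.
  by rewrite mulrnDl -subr_eq0 addrK.
have := fibres (fun=> 1); rewrite !sumr_const => cardV.
have V0 : #|V|%:R != 0 :> rat.
  by rewrite pnatr_eq0 -lt0n; apply/card_gt0P; exists 0.
have PK : #|P|%:R * K = #|V|%:R by rewrite mulrC -cardV.
by rewrite fibres mulrA [_ / _ * K]mulrAC PK divff ?mul1r.
Qed.

(** * Divisibility by [p] in the residues modulo [p ^ N] *)

Section PrimePower.
Variables p N : nat.
Hypotheses (p_prime : prime p) (N_gt0 : (0 < N)%N).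
Local Notation Z := 'Z_(p ^ N).
Let q : rat := p%:R^-1.
Let r : rat := (p ^ N)%:R.
(** The number of residues divisible by [p]. *)
Let t : rat := (p ^ N.-1)%:R.

Lemma pN_gt1 : (1 < p ^ N)%N.
Proof. by rewrite -(expn0 p) ltn_exp2l ?prime_gt1. Qed.

Lemma t_over_r : t / r = q.
Proof.
rewrite /t /r /q -{2}(prednK N_gt0) expnS natrM invfM mulrCA divff ?mulr1 //.
by rewrite pnatr_eq0 -lt0n expn_gt0 prime_gt0.
Qed.

Lemma dvd_modn d m n : (d %| m)%N -> (d %| n %% m)%N = (d %| n)%N.
Proof. by move=> dm; rewrite {2}(divn_eq n m) dvdn_addr // dvdn_mull. Qed.

Lemma dvd_mulZ mu (x y : Z) : (mu <= N)%N ->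
  (p ^ mu %| (x * y)%R)%N = (p ^ mu %| x * y)%N.
Proof. by move=> mN; rewrite /= dvd_modn // Zp_cast ?pN_gt1 // dvdn_exp2l. Qed.

Lemma unitZ (x : Z) : (x \is a GRing.unit) = ~~ (p %| x)%N.
Proof.
by rewrite -{1}[x]natr_Zp unitZpE ?pN_gt1 // coprime_pexpl // prime_coprime.
Qed.

Lemma dvdZP (x : Z) : reflect (exists y : Z, x = y *+ p) (p %| x)%N.
Proof.
apply: (iffP idP) => [/dvdnP[k xE]|[y ->]].
  by exists k%:R; rewrite -mulrnA -xE natr_Zp.
by rewrite -mulr_natl -[p in (p %| _)%N]expn1 dvd_mulZ // val_Zp_nat ?pN_gt1 //
  expn1 dvdn_mulr // dvd_modn // dvdn_exp.
Qed.

Lemma card_multiples : #|[pred x : Z | (p %| x)%N]| = (p ^ N.-1)%N.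
Proof.
have E : (#|[pred x : Z | p %| x]| + totient (p ^ N) = p ^ N)%N.
  rewrite totient_count_coprime -sum1_card big_mkcond /=.
  rewrite -(big_mkord xpredT (fun i => if (p %| i)%N then 1 else 0)%N).
  rewrite Zp_cast ?pN_gt1 // -big_split /=.
  rewrite -[RHS]muln1 -[X in (X * 1)%N]subn0 -sum_nat_const_nat.
  apply: eq_bigr => i _; rewrite coprime_pexpl // prime_coprime //.
  by case: (p %| i)%N.
have pNE : (p ^ N = p ^ N.-1 + p.-1 * p ^ N.-1)%N.
  by rewrite -mulSn prednK ?prime_gt0 // -expnS prednK.
by apply/eqP; rewrite -(eqn_add2r (p.-1 * p ^ N.-1)) -pNE -totient_pfactor // E.
Qed.

Lemma cardZ : #|{: Z}| = (p ^ N)%N.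
Proof. by rewrite card_ord Zp_cast ?pN_gt1. Qed.

Lemma sum_multiplesZ (F : Z -> rat) :
  \sum_(a : Z | (p %| a)%N) F a = q * \sum_a F (a *+ p).
Proof.
by rewrite (sum_multiples _ dvdZP) card_multiples
  cardZ t_over_r.
Qed.

Definition dvd_row n (b : 'rV[Z]_n) : bool := [forall j, (p %| b 0%R j)%N].

Lemma dvd_rowP n (b : 'rV[Z]_n) : reflect (exists c, b = c *+ p) (dvd_row b).
Proof.
apply: (iffP forallP) => [dvdb|[c ->] j]; last first.
  by apply/dvdZP; exists (c 0 j); rewrite mulmxnE.
exists (\row_j (b 0%R j %/ p)%N%:R); apply/rowP=> j.
by rewrite mulmxnE mxE -mulrnA divnK // natr_Zp.
Qed.

Lemma card_dvd_row n : #|[pred b : 'rV[Z]_n | dvd_row b]| = ((p ^ N.-1) ^ n)%N.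
Proof.
transitivity #|@ffun_on 'I_n [pred x : Z | (p %| x)%N]|; last first.
  by rewrite card_ffun_on card_ord card_multiples.
rewrite -!sum1_card.
rewrite (reindex (fun f : {ffun 'I_n -> Z} => \row_j f j)) /=.
  apply: eq_bigl => f; rewrite !inE; apply/forallP/ffun_onP => + j => /(_ j).
    by rewrite mxE inE.
  by rewrite mxE inE.
exists (fun b : 'rV[Z]_n => [ffun j => b 0 j]) => [f _|b _].
  by apply/ffunP => j; rewrite ffunE mxE.
by apply/rowP => j; rewrite mxE ffunE.
Qed.

Lemma sum_dvd_row n (F : 'rV[Z]_n -> rat) :
  \sum_(b | dvd_row b) F b = q ^+ n * \sum_b F (b *+ p).
Proof.
rewrite (sum_multiples _ (@dvd_rowP n)) card_dvd_row card_mx.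
by rewrite cardZ mul1n -t_over_r expr_div_n /t /r !natrX.
Qed.

(* For [mu <= N] this does not depend on the representative of [x], so all the
   moduli [p ^ mu] can be treated inside the single ring [Z]. *)
Definition nz mu (x : Z) : rat := (~~ (p ^ mu %| x)%N)%:R.

Lemma nz0 x : nz 0 x = 0.
Proof. by rewrite /nz expn0 dvd1n. Qed.

Lemma nz_unitM mu u x : (mu <= N)%N -> u \is a GRing.unit -> nz mu (u * x) = nz mu x.
Proof.
move=> muN; rewrite unitZ /nz dvd_mulZ // => pu.
by rewrite Gauss_dvdr // coprimeXl // prime_coprime.
Qed.

Lemma nz_pM mu x : (mu <= N)%N -> nz mu (p%:R * x) = nz mu.-1 x.
Proof.
case: mu => [|mu] muN; first by rewrite !nz0.
rewrite /nz dvd_mulZ // val_Zp_nat ?pN_gt1 //.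
(* The residue of [p] is [p] itself unless [N = 1], where it is 0. *)
have [Np | pN] := ltnP p (p ^ N).
  by rewrite modn_small // expnS dvdn_pmul2l ?prime_gt0.
have N1 : (N = 1)%N.
  apply/eqP; rewrite eqn_leq N_gt0 andbT.
  by rewrite -(leq_exp2l _ _ (prime_gt1 p_prime)) expn1.
have -> : mu = 0%N by lia.
by rewrite expn1 expn0 dvd1n dvdn_mulr // dvd_modn // dvdn_exp.
Qed.

(** * Elimination on the first row, case by case *)

Definition sym_nz mu n : rat := \sum_(A : 'M[Z]_n | A^T == A) nz mu (\det A).

Lemma sym_nz0 n : sym_nz 0 n = 0.
Proof. by rewrite /sym_nz big1 // => A _; rewrite nz0. Qed.

(** The Schur complement only translates [D] by a symmetric matrix. The symmetric case is [k = 1];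
    [k = p] occurs once a factor [p] has left the first row but not the first column. *)
Lemma sum_pivot mu n a k (b : 'rV[Z]_n) : (mu <= N)%N -> a \is a GRing.unit ->
  \sum_(D : 'M[Z]_n | D^T == D) nz mu (\det (block_mx a%:M b (k *: b^T) D))
  = sym_nz mu n.
Proof.
move=> muN unita; rewrite /sym_nz.
rewrite -[RHS](@sum_sym_shift _ _ (- (a^-1 *: (k *: b^T *m b)))).
  by apply: eq_bigr => D _; rewrite det_pivot // nz_unitM.
by rewrite -scalemxAl scalerA -scaleNr linearZ /= trmx_mul trmxK.
Qed.

(** First half of eliminating the 2 x 2 pivot with rows (a, 1) and (1, d). The new corner
    [a * d - 1] is a unit when [p] divides [a], and the column [a *: c'] has the shape that
    [sum_pivot] accepts with [k = a]. *)
Lemma det_block_e1 n (a d : Z) (c : 'rV[Z]_n) (c' : 'cV[Z]_n) (E : 'M[Z]_n)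
    (e : 'rV[Z]_(1 + n)) : e = row_mx 1%:M 0 ->
  \det (block_mx a%:M e e^T (block_mx d%:M c c' E))
  = \det (block_mx (a * d - 1)%:M c (a *: c') E).
Proof.
move=> eE.
have ee : e *m e^T = 1%:M.
  by rewrite eE tr_row_mx trmx0 mul_row_col trmx1 mulmx1 mulmx0 addr0.
set D := block_mx d%:M c c' E.
(* Adding (1 - a) times the second column to the first creates the pivot 1. *)
have -> : \det (block_mx a%:M e e^T D) =
    \det (block_mx a%:M e e^T D *m block_mx 1%:M 0 ((1 - a) *: e^T) 1%:M).
  by rewrite det_mulmx det_lblock !det1 !mulr1.
rewrite mulmx_block !mulmx1 !mulmx0 !add0r -!scalemxAr ee.
rewrite scale_scalar_mx mulr1 -raddfD addrC subrK det_pivot ?unitr1 //.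
rewrite mul1r invr1 scale1r; congr (\det _).
rewrite /D eE tr_row_mx trmx1 trmx0.
rewrite mul_block_col !mulmx0 !addr0 !mulmx1 scale_col_mx add_col_mx mul_col_row.
rewrite !mulmx0 !mulmx1 opp_block_mx add_block_mx !oppr0 !addr0.
congr block_mx; last by rewrite scalerBl scale1r add0r opprB addrCA subrr addr0.
rewrite scale_scalar_mx -raddfD -raddfN -raddfD; congr _%:M.
ring.
Qed.

Lemma sum_row (n : nat) (x : rat) : \sum_(b : 'rV[Z]_n) x = r ^+ n * x.
Proof. by rewrite sumr_const card_mx cardZ mul1n -mulr_natl natrX. Qed.

Lemma sum_row_unit mu n (a : Z) (b : 'rV[Z]_(1 + n)) : (mu <= N)%N ->
  (p %| a)%N -> ~~ dvd_row b ->
  \sum_(D : 'M[Z]_(1 + n) | D^T == D) nz mu (\det (block_mx a%:M b b^T D))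
  = r ^+ n.+1 * sym_nz mu n.
Proof.
move=> muN pa; rewrite /dvd_row negb_forall => /existsP[j].
rewrite -unitZ => /unit_row_completion[U unitU bU].
(* The congruence by [U] multiplies the determinant by this unit. *)
have unitU2 : (\det U * \det U) \is a GRing.unit by rewrite unitrM -unitmxE unitU.
pose e := b *m U.
have detU D : nz mu (\det (block_mx a%:M b b^T D))
    = nz mu (\det (block_mx a%:M e e^T (U^T *m D *m U))).
  have -> : block_mx a%:M e e^T (U^T *m D *m U)
      = block_mx 1%:M 0 0 U^T *m block_mx a%:M b b^T D *m block_mx 1%:M 0 0 U.
    rewrite !mulmx_block !mul1mx !mul0mx !mulmx0 !mulmx1 !addr0 !add0r.
    by rewrite trmx_mul.
  rewrite !det_mulmx !det_lblock !det1 !mul1r det_tr mulrC mulrA.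
  by rewrite nz_unitM.
under eq_bigr => D _ do rewrite detU.
rewrite (sum_sym_congruence (fun D => nz mu (\det (block_mx a%:M e e^T D)))) //.
rewrite sum_sym_block.
transitivity (\sum_(d : Z) \sum_(c : 'rV[Z]_n) sym_nz mu n).
  apply: eq_bigr => d _; apply: eq_bigr => c _.
  (* This is -1 modulo [p], since [p] divides [a]. *)
  have unitad : (a * d - 1) \is a GRing.unit.
    rewrite unitZ; apply/negP => /dvdZP[y yE].
    have: ~~ (p %| (1%R : Z))%N by rewrite -unitZ unitr1.
    move/negP; apply; apply/dvdZP.
    move/dvdZP: pa => [x xE]; exists (x * d - y).
    by rewrite mulrnBl -mulrnAl -xE -yE opprB addrC subrK.
  rewrite -(sum_pivot a c muN unitad); apply: eq_bigr => E _.
  by rewrite (det_block_e1 _ _ _ _ _ bU).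
by rewrite sumr_const cardZ sum_row -mulr_natl mulrA -/r -exprS.
Qed.

Lemma sum_unit (x : rat) : \sum_(a : Z | ~~ (p %| a)%N) x = (r - t) * x.
Proof.
have := cardC [pred a : Z | (p %| a)%N]; rewrite card_multiples cardZ => E.
have <- : t + #|[predC [pred a : Z | (p %| a)%N]]|%:R = r by rewrite -natrD E.
by rewrite sumr_const addrAC subrr add0r mulr_natl.
Qed.

Lemma sum_primitive_row n (x : rat) :
  \sum_(b : 'rV[Z]_n | ~~ dvd_row b) x = (r ^+ n - t ^+ n) * x.
Proof.
have := cardC [pred b : 'rV[Z]_n | dvd_row b].
rewrite card_dvd_row card_mx cardZ mul1n => E.
have <- : t ^+ n + #|[predC [pred b : 'rV[Z]_n | dvd_row b]]|%:R = r ^+ n.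
  by rewrite -!natrX -natrD E.
by rewrite sumr_const addrAC subrr add0r mulr_natl.
Qed.

(** The factor [q ^+ n.+1] is the density of rows divisible by [p]. The predecessors truncate at 0,
    where [sym_nz] vanishes, in accordance with the boundary convention. *)
Lemma sum_row_dvd mu n : (mu <= N)%N ->
  \sum_(a : Z | (p %| a)%N) \sum_(b : 'rV[Z]_n | dvd_row b)
    \sum_(D : 'M[Z]_n | D^T == D) nz mu (\det (block_mx a%:M b b^T D))
  = q ^+ n.+1 * ((r - t) * r ^+ n * sym_nz mu.-1 n + q * sym_nz mu.-2 n.+1).
Proof.
move=> muN; have mu1N : (mu.-1 <= N)%N by lia.
under eq_bigr => a _ do rewrite sum_dvd_row.
rewrite -mulr_sumr sum_multiplesZ mulrA -exprSr; congr (_ * _).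
transitivity (\sum_(a : Z) \sum_(b : 'rV[Z]_n) \sum_(D : 'M[Z]_n | D^T == D)
    nz mu.-1 (\det (block_mx a%:M b (p%:R *: b^T) D))).
  apply: eq_bigr => a _; apply: eq_bigr => b _; apply: eq_bigr => D _.
  by rewrite -(mulr_natl a) -(scaler_nat _ b) det_scale_row nz_pM // linearZ.
rewrite (bigID (fun a : Z => (p %| a)%N)) /= addrC; congr (_ + _).
  rewrite -mulrA -sum_row -sum_unit; apply: eq_bigr => a pa.
  by apply: eq_bigr => b _; rewrite sum_pivot // unitZ.
rewrite sum_multiplesZ; congr (_ * _).
rewrite /sym_nz (@sum_sym_block _ n).
apply: eq_bigr => a _; apply: eq_bigr => b _; apply: eq_bigr => D _.
by rewrite -(mulr_natl a) det_scale_col nz_pM.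
Qed.

Lemma sym_nz_rec mu n : (mu <= N)%N ->
  sym_nz mu n.+1 = (r - t) * r ^+ n * sym_nz mu n
    + t * (r ^+ n - t ^+ n) * r ^+ n * sym_nz mu n.-1
    + q ^+ n.+1 * ((r - t) * r ^+ n * sym_nz mu.-1 n + q * sym_nz mu.-2 n.+1).
Proof.
move=> muN; rewrite [LHS]/sym_nz (@sum_sym_block _ n).
rewrite (bigID (fun a : Z => (p %| a)%N)) /= addrC -addrA; congr (_ + _).
  rewrite -mulrA -sum_row -sum_unit; apply: eq_bigr => a pa.
  apply: eq_bigr => b _; rewrite -(@sum_pivot mu n a 1 b) ?unitZ //.
  by rewrite scale1r.
under eq_bigr => a _ do rewrite (bigID (@dvd_row n)) /= addrC.
rewrite big_split sum_row_dvd //=; congr (_ + _).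
(* An empty row is divisible by [p], so this case is void; on the right [r ^+ 0 - t ^+ 0 = 0]
   removes the term at [0.-1]. *)
case: n => [|n].
  rewrite !expr0 subrr mulr0 !mul0r big1 // => a _; rewrite big1 // => b.
  by case/negP; apply/forallP => -[].
rewrite -!mulrA mulrC -mulrA.
transitivity (\sum_(a : Z | (p %| a)%N) \sum_(b : 'rV[Z]_n.+1 | ~~ dvd_row b)
    (r ^+ n.+1 * sym_nz mu n)).
  by apply: eq_bigr => a pa; apply: eq_bigr => b pb; rewrite -(sum_row_unit muN pa pb).
under eq_bigr => a _ do rewrite sum_primitive_row.
rewrite sumr_const card_multiples -[LHS]mulr_natl -/t /=; ring.
Qed.

Lemma card_sym_rec n :
  #|symmetric_mx (p ^ N) n.+1|%:R = r ^+ n.+1 * #|symmetric_mx (p ^ N) n|%:R :> rat.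
Proof.
have cardE m : #|symmetric_mx (p ^ N) m|%:R = \sum_(A : 'M[Z]_m | A^T == A) 1 :> rat.
  by rewrite -sum1_card natr_sum; apply: eq_bigl => A; rewrite inE.
rewrite !cardE (@sum_sym_block _ n).
by rewrite sumr_const sum_row cardZ -mulr_natl mulrA -/r -exprS.
Qed.

Lemma card_sym_neq0 n : #|symmetric_mx (p ^ N) n|%:R != 0 :> rat.
Proof.
rewrite pnatr_eq0 -lt0n; apply/card_gt0P; exists 0.
by rewrite inE trmx0.
Qed.

Definition sym_prob mu n : rat := sym_nz mu n / #|symmetric_mx (p ^ N) n|%:R.

(** After normalisation all powers of [r] cancel through [t = q * r], and [N] survives only in the
    bound on [mu]. *)
Lemma sym_prob_rec mu n : (mu <= N)%N ->
  sym_prob mu n.+1 = (1 - q) * sym_prob mu n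
    + q * (1 - q ^+ n) * sym_prob mu n.-1
    + q ^+ n.+1 * ((1 - q) * sym_prob mu.-1 n + q * sym_prob mu.-2 n.+1).
Proof.
move=> muN.
have r0 : r != 0 by rewrite pnatr_eq0 -lt0n expn_gt0 prime_gt0.
have rn0 : r ^+ n != 0 by rewrite expf_neq0.
have tE : t = q * r by rewrite -t_over_r divfK.
rewrite /sym_prob sym_nz_rec // card_sym_rec tE exprMn.
have s0 := card_sym_neq0 n.
case: n => [|n] in rn0 s0 *.
  rewrite !expr0 expr1 /=.
  by field; rewrite r0 s0.
move: s0; rewrite /= (card_sym_rec n) mulf_eq0 negb_or => /andP[_ s0].
rewrite (exprS r n.+1).
move: (r ^+ n.+1) rn0 => rn rn0.
by field; rewrite rn0 r0 s0.
Qed.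

End PrimePower.

(** * Solving the recurrence with the shift x *)

Section LinearRecurrence.
Variables (q : rat) (f : nat -> int -> rat).
Hypothesis f_le0 : forall n mu, mu <= 0 -> f n mu = 0.
Hypothesis f_rec : forall n mu,
  f n.+1 mu = (1 - q) * f n mu + q * (1 - q ^+ n) * f n.-1 mu
    + q ^+ n.+1 * ((1 - q) * f n (mu - 1) + q * f n.+1 (mu - 2)).

(* Cancellation of the factor [1 - c x ^ d]. *)
Lemma shift_eigen_eq0 (g : int -> rat) c d : 0 < d ->
  (forall mu, mu <= 0 -> g mu = 0) -> (forall mu, g mu = c * g (mu - d)) ->
  forall mu, g mu = 0.
Proof.
move=> d0 g_le0 gE mu; have [k] := ubnP `|mu|%N.
elim: k mu => // k IH mu muk; have [/g_le0 //|mu0] := lerP mu 0.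
rewrite gE; have [le0|gt0] := lerP (mu - d) 0; first by rewrite g_le0 ?mulr0.
by rewrite IH ?mulr0 //; lia.
Qed.

Definition odd_relation n := forall mu,
  f n mu - q ^+ n * f n (mu - 1) = (1 - q ^+ n) * f n.-1 mu.

Definition even_relation n := forall mu,
  f n mu - q ^+ n.+1 * f n (mu - 2) = f n.-1 mu - q ^+ n.+1 * f n.-1 (mu - 1).

(** The odd relation replaces (1 - q^(m+1)) f_m in the recurrence, after which the terms q^(m+2) x
    f_(m+1) cancel. *)
Lemma even_step m : odd_relation m.+1 -> even_relation m.+2.
Proof.
move=> A mu; move: (A mu) (f_rec m.+1 mu) => /= {}A R.
have -> : f m.+2 mu = q ^+ m.+3 * f m.+2 (mu - 2) + (1 - q) * f m.+1 mu
    + q * ((1 - q ^+ m.+1) * f m mu) + q ^+ m.+2 * (1 - q) * f m.+1 (mu - 1).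
  rewrite R !exprS; ring.
rewrite -A !exprS; ring.
Qed.

(* The difference of the two sides is multiplied by [q ^ (m + 3) x ^ 2] when the
   recurrence is multiplied by [1 - q ^ (m + 2) x]. *)
Lemma odd_step m : even_relation m.+1 -> odd_relation m.+2.
Proof.
move=> C mu; apply/eqP; rewrite -subr_eq0 /=; apply/eqP; move: mu.
apply: (@shift_eigen_eq0 _ (q ^+ m.+3) 2) => // mu.
  by move=> mu0; rewrite !f_le0 ?mulr0 ?subrr //; lia.
move: (C mu) (f_rec m.+1 mu) (f_rec m.+1 (mu - 1)) => /= {}C.
rewrite (_ : mu - 1 - 1 = mu - 2); last lia.
rewrite (_ : mu - 1 - 2 = mu - 2 - 1); last lia.
move=> -> ->.
have -> : f m.+1 mu = q ^+ m.+2 * f m.+1 (mu - 2)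
    + (f m mu - q ^+ m.+2 * f m (mu - 1)) by rewrite -C; ring.
rewrite !exprS; ring.
Qed.

(** The recurrence reads (1 - q^2 x^2) f_1 = (1 - q) (1 + q x) f_0; the factor 1 + q x is
    cancelled. *)
Lemma odd_relation1 : odd_relation 1.
Proof.
move=> mu; apply/eqP; rewrite -subr_eq0 /=; apply/eqP; move: mu.
apply: (@shift_eigen_eq0 _ (- q) 1) => // mu.
  by move=> mu0; rewrite !f_le0 ?mulr0 ?subrr //; lia.
rewrite (_ : mu - 1 - 1 = mu - 2); last lia.
rewrite (f_rec 0 mu) /= expr1 expr0; ring.
Qed.

Lemma odd_relation_odd n : odd n -> odd_relation n.
Proof.
elim/ltn_ind: n => -[|[|[|n]]] IH //= on; first exact: odd_relation1.
by apply/odd_step/even_step/IH => //; rewrite negbK in on.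
Qed.

(** The odd relation at n and the even one at n - 1 combine to (1 - q^n x) (1 - q^n x^2) f_n = (1 -
    q^n) (1 - q^n x) f_(n-2); the factor 1 - q^n x is cancelled. *)
Lemma odd_double_step n mu : odd n -> (3 <= n)%N ->
  f n mu = (1 - q ^+ n) * f (n - 2)%N mu + q ^+ n * f n (mu - 2).
Proof.
case: n => [|[|[|n]]] // on _.
have A := odd_relation_odd on.
have /even_step C : odd_relation n.+1 by apply: odd_relation_odd; rewrite /= negbK in on.
have -> : (n.+3 - 2 = n.+1)%N by lia.
apply/eqP; rewrite -subr_eq0; apply/eqP; move: mu.
apply: (@shift_eigen_eq0 _ (q ^+ n.+3) 1) => // mu.
  by move=> mu0; rewrite !f_le0 ?mulr0 ?addr0 ?subrr //; lia.
move: (A mu) (A (mu - 2)) (C mu) => /= {}A A2 {}C.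
rewrite (_ : mu - 1 - 2 = mu - 2 - 1); last lia.
have -> : f n.+3 mu = (1 - q ^+ n.+3) * f n.+2 mu + q ^+ n.+3 * f n.+3 (mu - 1).
  rewrite -A; ring.
have -> : f n.+2 mu = q ^+ n.+3 * f n.+2 (mu - 2)
    + (f n.+1 mu - q ^+ n.+3 * f n.+1 (mu - 1)) by rewrite -C; ring.
have -> : f n.+3 (mu - 2) = (1 - q ^+ n.+3) * f n.+2 (mu - 2)
    + q ^+ n.+3 * f n.+3 (mu - 2 - 1) by rewrite -A2; ring.
ring.
Qed.

End LinearRecurrence.

(** * Independence of [N] and passage to [Pnp] *)

Lemma sym_prob_size0 p N mu : prime p -> (0 < N)%N -> (0 < mu)%N ->
  sym_prob p N mu 0 = 1.
Proof.
move=> pp N0 mu0; rewrite /sym_prob.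
suff -> : sym_nz p N mu 0 = #|symmetric_mx (p ^ N) 0|%:R.
  by rewrite divff // card_sym_neq0.
rewrite /sym_nz -sum1_card natr_sum; apply: eq_big => [A|A _]; first by rewrite inE.
rewrite det_mx00 /nz dvdn1 -[1%N](expn0 p) eqn_exp2l ?prime_gt1 //.
by rewrite -lt0n mu0.
Qed.

(* The recurrence and the boundary values do not involve N. *)
Lemma sym_prob_modulus p N N' mu n : prime p -> (0 < N)%N -> (0 < N')%N ->
  (mu <= N)%N -> (mu <= N')%N -> sym_prob p N mu n = sym_prob p N' mu n.
Proof.
move=> pp N0 N'0; elim/ltn_ind: mu n => -[|mu] IHmu n muN muN'.
  by rewrite /sym_prob !sym_nz0 !mul0r.
elim/ltn_ind: n => -[|n] IHn; first by rewrite !sym_prob_size0.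
rewrite (sym_prob_rec pp N0 n muN) (sym_prob_rec pp N'0 n muN') /=.
rewrite (IHn n) // (IHn n.-1); last lia.
by rewrite (IHmu mu) // ?(IHmu mu.-1) //; lia.
Qed.

Lemma Pnp_le0 p n mu : mu <= 0 -> Pnp p n mu = 0.
Proof. by rewrite /Pnp => ->. Qed.

Lemma Pnp_sym_prob p N n k : prime p -> (0 < N)%N -> (k <= N)%N ->
  Pnp p n k%:Z = sym_prob p N k n.
Proof.
move=> pp N0; case: k => [|k] kN; first by rewrite Pnp_le0 // /sym_prob sym_nz0 mul0r.
(* With the exponent of the modulus equal to [k.+1], divisibility by [p ^ k.+1] becomes vanishing in
   the ring. *)
rewrite (@sym_prob_modulus p N k.+1) // /Pnp /= /prob_nonsing_sym /sym_prob.
congr (_ / _); rewrite -sum1_card natr_sum /sym_nz.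
rewrite big_mkcond [RHS]big_mkcond /=; apply: eq_bigr => A _.
rewrite !inE; case: (A^T == A) => //=; rewrite /nz.
suff -> : (p ^ k.+1 %| \det A)%N = (\det A == 0) by case: (\det A == 0).
apply/idP/eqP => [dvd|->]; last exact: dvdn0.
apply/val_inj/eqP; rewrite /= -leqn0 leqNgt; apply/negP => /dvdn_leq/(_ dvd).
by rewrite leqNgt -[X in (_ < X)%N]Zp_cast ?pN_gt1 ?ltn_ord.
Qed.

Lemma Pnp_rec p n mu : prime p -> let q : rat := p%:R^-1 in
  Pnp p n.+1 mu = (1 - q) * Pnp p n mu + q * (1 - q ^+ n) * Pnp p n.-1 mu
    + q ^+ n.+1 * ((1 - q) * Pnp p n (mu - 1) + q * Pnp p n.+1 (mu - 2)).
Proof.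
move=> pp q; have [mu0|mu0] := lerP mu 0.
  rewrite !Pnp_le0 ?mulr0 ?addr0 ?mulr0 //; lia.
case: mu mu0 => // -[//|k] _.
rewrite (_ : k.+1%:Z - 1 = k%:Z); last lia.
rewrite !(@Pnp_sym_prob p k.+1 _ _ pp) // sym_prob_rec //= -/q.
congr (_ + _ * (_ + _ * _)).
(* For [mu = 1] the exponent is -1 on the left and a truncated 0 on the right; both terms vanish. *)
case: k => [|k]; first by rewrite Pnp_le0 // /sym_prob sym_nz0 mul0r.
rewrite (_ : k.+2%:Z - 2 = k%:Z); last lia.
by rewrite (@Pnp_sym_prob p k.+2) //; lia.
Qed.

Theorem theorem4p1 (p : nat) (mu : int) :
  prime p -> 0 < mu ->
  let q : rat := (p%:R)^-1 in
  (forall n : nat, odd n -> (3 <= n)%N ->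
     Pnp p n mu = (1 - q ^+ n) * Pnp p (n - 2) mu + q ^+ n * Pnp p n (mu - 2))
  /\
  (forall n : nat, odd n -> (1 <= n)%N ->
     Pnp p (n - 1) mu = (Pnp p n mu - q ^+ n * Pnp p n (mu - 1)) / (1 - q ^+ n)).
Proof.
move=> pp _ q; have rec n nu := @Pnp_rec p n nu pp.
split=> n oddn n_ge.
  exact: (odd_double_step (@Pnp_le0 p) rec).
rewrite (odd_relation_odd (@Pnp_le0 p) rec oddn) subn1 mulrAC divff ?mul1r //.
rewrite subr_eq0 eq_sym lt_eqF // exprn_ilt1 ?invr_ge0 ?ler0n -?lt0n //.
by rewrite invf_lt1 ?ltr1n ?ltr0n ?prime_gt1 ?prime_gt0.
Qed.
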